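(* Let $\varphi$ be a renormalization of a finitely generated group $\Gamma$. Then the associated action $(X_{\varphi}, \Gamma, \Phi_{\varphi})$ is virtually renormalizable. Conversely, suppose that a minimal equicontinuous Cantor action $(\mathfrak{X},\Gamma,\Phi)$ is renormalizable and locally quasi-analytic. Then $\Gamma$ is renormalizable, and there is a renormalization $\varphi$ of $\Gamma$ such that $(\mathfrak{X},\Gamma,\Phi)$ is isomorphic to $(X_{\varphi}, \Gamma, \Phi_{\varphi})$.
   Context: A Cantor action $(\mathfrak{X},\Gamma,\Phi)$ is a minimal action $\Phi\colon\Gamma\times\mathfrak{X}\to\mathfrak{X}$ by homeomorphisms of a finitely generated group $\Gamma$ on a Cantor metric space $\mathfrak{X}$. Two Cantor actions $(\mathfrak{X},\Gamma,\Phi)$, $(\mathfrak{X}',\Gamma',\Phi')$ are isomorphic if there are a homeomorphism $h\colon\mathfrak{X}\to\mathfrak{X}'$ and a group isomorphism $\Theta\colon\Gamma\to\Gamma'$ with $\Phi(\gamma)=h^{-1}\circ\Phi'(\Theta(\gamma))\circ h$ for all $\gamma\in\Gamma$. A set $U\subset\mathfrak{X}$ is adapted to the action if it is non-empty, clopen, and $\Phi(\gamma)(U)\cap U\neq\emptyset$ implies $\Phi(\gamma)(U)=U$ for all $\gamma\in\Gamma$. For $U$ adapted, $\Gamma_U=\{\gamma\in\Gamma\mid\Phi(\gamma)(U)=U\}$, $H_U\subset\mathrm{Homeo}(U)$ is the image of $\Gamma_U$ under restriction to $U$, and $(U,H_U,\Phi_U)$ is the resulting action of $H_U$ on $U$.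 A Cantor action $(\mathfrak{X},\Gamma,\Phi)$ is renormalizable if it is equicontinuous and there exists an adapted proper clopen subset $U\subset\mathfrak{X}$ such that $(\mathfrak{X},\Gamma,\Phi)$ and $(U,H_U,\Phi_U)$ are isomorphic by a homeomorphism $\lambda\colon\mathfrak{X}\to U$ and an isomorphism $\Theta\colon\Gamma\to H_U$, and $\bigcap_{\ell\ge0}\lambda^\ell(\mathfrak{X})$ is a point. It is virtually renormalizable if it is equicontinuous and there exists an adapted set $V\subset\mathfrak{X}$ such that $(V,H_V,\Phi_V)$ is renormalizable. An action $\Phi\colon H\times\mathfrak{X}\to\mathfrak{X}$ is locally quasi-analytic if there is $\varepsilon>0$ such that for any non-empty open $U$ with $\mathrm{diam}(U)<\varepsilon$ and any non-empty open $V\subset U$, if $g\in H$ satisfies $\Phi(g)(V)=V$ and $\Phi(g)|V=\mathrm{id}_V$, then $\Phi(g)$ is the identity on $U$. A renormalization of $\Gamma$ is an injective homomorphism $\varphi\colon\Gamma\to\Gamma$ whose image is a proper subgroup of finite index; $\Gamma$ is renormalizable if it admits one. The associated action $(X_\varphi,\Gamma,\Phi_\varphi)$ is the action of $\Gamma$ by left translation on the Cantor space $X_\varphi=\varprojlim\Gamma/\varphi^\ell(\Gamma)$. *)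

(* Defs.v *)
From HB Require Import structures.
From mathcomp Require Import all_boot all_order all_algebra.
From mathcomp Require Import all_classical all_reals all_analysis.

Set Implicit Arguments.
Unset Strict Implicit.
Unset Printing Implicit Defensive.

Import Order.TTheory GRing.Theory Num.Theory.

Local Open Scope classical_set_scope.
Local Open Scope ring_scope.

Definition finitely_generated (G : groupType) : Prop :=
  exists s : seq G, forall S : {pred G},
    group_closed S -> {subset s <= S} -> forall x, x \in S.

Definition lmul (G : groupType) (g : G) (C : set G) : set G :=
  [set (g * c)%g | c in C].

Lemma lmul1 (G : groupType) (C : set G) : lmul 1%g C = C.
Proof.
rewrite /lmul; apply/seteqP; split=> [_ [c Cc <-]|c Cc]; first by rewrite mul1g.
by exists c => //; rewrite mul1g.
Qed.

Lemma lmulM (G : groupType) (g h : G) (C : set G) :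
  lmul (g * h)%g C = lmul g (lmul h C).
Proof.
apply/seteqP; split=> [_ [c Cc <-]|_ [_ [c Cc <-] <-]].
  by exists (h * c)%g; rewrite ?mulgA//; exists c.
by exists c; rewrite ?mulgA.
Qed.

Definition finite_index (G : groupType) (H : set G) : Prop :=
  finite_set (range (fun g : G => lmul g H)).

Definition renormalization (G : groupType) (phi : {multiplicative G -> G}) :
  Prop :=
  [/\ injective phi, range phi `<` [set: G] & finite_index (range phi)].

Definition group_renormalizable (G : groupType) : Prop :=
  exists phi : {multiplicative G -> G}, renormalization phi.

Definition homeo_pair (X Y : topologicalType) (h : X -> Y) (k : Y -> X) :
  Prop :=
  [/\ cancel h k, cancel k h, continuous h & continuous k].

(* A homeomorphism is stored with its inverse, which it determines. *)
Section Homeo.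
Variable X : topologicalType.

Record homeo : Type := Homeo {
  homeo_val : (X -> X) * (X -> X);
  homeo_valP : `[< homeo_pair homeo_val.1 homeo_val.2 >] }.

HB.instance Definition _ := [isSub for homeo_val].
HB.instance Definition _ := gen_eqMixin homeo.
HB.instance Definition _ := gen_choiceMixin homeo.

Definition homeo_fun (h : homeo) : X -> X := (homeo_val h).1.
Coercion homeo_fun : homeo >-> Funclass.

Lemma homeoP (h : homeo) : homeo_pair (homeo_val h).1 (homeo_val h).2.
Proof. exact/asboolP/homeo_valP. Qed.

Lemma homeo_eq (h k : homeo) : h =1 k -> h = k.
Proof.
case: h k => [[f f'] hf] [[g g'] hg] /= /funext; rewrite /homeo_fun /= => fg.
subst g; apply: val_inj => /=; congr pair; apply/funext => x.
move: hf hg => /asboolP [fK f'K _ _] /asboolP [_ g'K _ _].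
by rewrite /= in fK f'K g'K; rewrite -[in LHS](g'K x) fK.
Qed.

Fact homeo1_subproof :
  `[< homeo_pair ((id, id) : (X -> X) * (X -> X)).1
                 ((id, id) : (X -> X) * (X -> X)).2 >].
Proof. by apply/asboolP; split => // x; exact: cvg_id. Qed.
Definition homeo1 : homeo := Homeo homeo1_subproof.

Fact homeoM_subproof (h k : homeo) :
  let p := ((homeo_val h).1 \o (homeo_val k).1,
            (homeo_val k).2 \o (homeo_val h).2) in
  `[< homeo_pair p.1 p.2 >].
Proof.
move: (homeoP h) (homeoP k) => [hK h'K ch ch'] [kK k'K ck ck'].
apply/asboolP; split => /=.
- by move=> x /=; rewrite hK kK.
- by move=> x /=; rewrite k'K h'K.
- by move=> x; apply: continuous_comp; [exact: ck|exact: ch].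
- by move=> x; apply: continuous_comp; [exact: ch'|exact: ck'].
Qed.
Definition homeoM (h k : homeo) : homeo := Homeo (homeoM_subproof h k).

Fact homeoV_subproof (h : homeo) :
  let p := ((homeo_val h).2, (homeo_val h).1) in `[< homeo_pair p.1 p.2 >].
Proof. by apply/asboolP; case: (homeoP h) => *; split. Qed.
Definition homeoV (h : homeo) : homeo := Homeo (homeoV_subproof h).

Fact homeoA : associative homeoM.
Proof. by move=> f g h; apply: homeo_eq. Qed.
Fact homeo1M : left_id homeo1 homeoM.
Proof. by move=> f; apply: homeo_eq. Qed.
Fact homeoM1 : right_id homeo1 homeoM.
Proof. by move=> f; apply: homeo_eq. Qed.
Fact homeoVM : left_inverse homeo1 homeoV homeoM.
Proof.
by move=> f; apply: homeo_eq => x; case: (homeoP f) => fK _ _ _; apply: fK.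
Qed.
Fact homeoMV : right_inverse homeo1 homeoV homeoM.
Proof.
by move=> f; apply: homeo_eq => x; case: (homeoP f) => _ fK _ _; apply: fK.
Qed.

HB.instance Definition _ :=
  isGroup.Build homeo homeoA homeo1M homeoM1 homeoVM homeoMV.

End Homeo.

Record homeo_action (G : groupType) (X : topologicalType) := HomeoAction {
  act :> G -> X -> X;
  act1 : forall x, act 1%g x = x;
  actM : forall g h x, act (g * h)%g x = act g (act h x);
  act_continuous : forall g, continuous (act g) }.

Definition minimal_action (G : groupType) (X : topologicalType)
    (Phi : homeo_action G X) : Prop :=
  forall x : X, dense (range (fun g => Phi g x)).

(* The empty space satisfies [cantor_like]. *)
Definition cantor_space_like (X : topologicalType) : Prop :=
  [set: X] !=set0 /\ cantor_like X.

Definition cantor_action (R : realType) (G : groupType) (X : metricType R)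
    (Phi : homeo_action G X) : Prop :=
  [/\ finitely_generated G, cantor_space_like X & minimal_action Phi].

Definition equicontinuous_action (R : realType) (G : groupType)
    (X : metricType R) (Phi : homeo_action G X) : Prop :=
  forall e : R, 0 < e -> exists2 d : R, 0 < d &
    forall (x y : X) (g : G), mdist x y < d -> mdist (Phi g x) (Phi g y) < e.

Definition isomorphic_by (G G' : groupType) (X X' : topologicalType)
    (Phi : homeo_action G X) (Phi' : homeo_action G' X')
    (h : X -> X') (Theta : {multiplicative G -> G'}) : Prop :=
  bijective Theta /\
  exists2 k : X' -> X, homeo_pair h k &
    forall g : G, Phi g = k \o Phi' (Theta g) \o h.

Definition isomorphic (G G' : groupType) (X X' : topologicalType)
    (Phi : homeo_action G X) (Phi' : homeo_action G' X') : Prop :=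
  exists (h : X -> X') (Theta : {multiplicative G -> G'}),
    isomorphic_by Phi Phi' h Theta.

Definition adapted (G : groupType) (X : topologicalType)
    (Phi : homeo_action G X) (U : set X) : Prop :=
  [/\ U !=set0, clopen U &
      forall g, Phi g @` U `&` U !=set0 -> Phi g @` U = U].

Section SubsetMetric.
Context (R : realType) (X : metricType R) (A : set X).

Let dist (x y : A) : R := mdist (set_val x) (set_val y).

Let dist_ge0 x y : 0 <= dist x y. Proof. exact: mdist_ge0. Qed.

Let dist_positivity x y : dist x y = 0 -> x = y.
Proof. by move=> /mdist_positivity; exact: val_inj. Qed.

Let ballEdist (x : A) d : ball x d = [set y | dist x y < d].
Proof.
rewrite /ball /=; apply/seteqP; split => y /=.
  by rewrite /initial_ball ballEmdist.
by rewrite /initial_ball ballEmdist.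
Qed.

HB.instance Definition _ :=
  @PseudoMetric_isMetric.Build R A dist dist_ge0 dist_positivity ballEdist.

End SubsetMetric.

Section Holonomy.
Context (G : groupType) (X : topologicalType) (Phi : homeo_action G X).
Variable U : set X.

Definition stabilizer : set G := [set g | Phi g @` U = U].

(* The image H_U in Homeo(U) of the stabilizer of [U]: it is an effective
   quotient of the stabilizer, not the stabilizer itself. *)
Definition holonomy_pred : {pred homeo U} := fun h =>
  `[< exists2 g, stabilizer g &
      forall x : U, set_val (h x) = Phi g (set_val x) >].

Fact holonomy_group_closed : group_closed holonomy_pred.
Proof.
split=> [|h k /asboolP[g sg hE] /asboolP[f sf kE]]; apply/asboolP.
  exists 1%g => [|x]; last by rewrite act1.
  rewrite /stabilizer /=; apply/seteqP; split=> [_ [x Ux <-]|x Ux].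
    by rewrite act1.
  by exists x; rewrite ?act1.
have sV : Phi f^-1%g @` U = U.
  rewrite -[in LHS]sf; apply/seteqP; split=> [_ [_ [x Ux <-] <-]|x Ux].
    by rewrite -actM mulVg act1.
  by exists (Phi f x); [exists x|rewrite -actM mulVg act1].
exists (g / f)%g => [|x].
  rewrite /stabilizer /= -[RHS]sg -[in RHS]sV.
  apply/seteqP; split=> [_ [x Ux <-]|_ [_ [x Ux <-] <-]].
    by exists (Phi f^-1%g x); [exists x|rewrite actM].
  by exists x; rewrite // actM.
have kVE : set_val (k^-1%g x) = Phi f^-1%g (set_val x).
  have -> : set_val x = Phi f (set_val (k^-1%g x)).
    by rewrite -kE; congr set_val; case: (homeoP k) => _ /(_ x) + _ _.
  by rewrite -actM mulVg act1.
by rewrite actM -kVE -hE.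
Qed.

Record holonomy : Type := Holonomy {
  holonomy_val :> homeo U;
  holonomy_valP : holonomy_val \in holonomy_pred }.

HB.instance Definition _ := [isSub for holonomy_val].
HB.instance Definition _ := [Choice of holonomy by <:].
HB.instance Definition _ :=
  SubChoice_isSubGroup.Build _ _ holonomy holonomy_group_closed.

Fact holonomy_continuous (h : holonomy) : continuous (holonomy_val h).
Proof. by case: (homeoP (holonomy_val h)). Qed.

Definition holonomy_action : homeo_action holonomy U :=
  @HomeoAction holonomy U (fun h x => holonomy_val h x)
    (fun=> erefl) (fun _ _ _ => erefl) holonomy_continuous.

End Holonomy.

Definition renormalizable (R : realType) (G : groupType) (X : metricType R)
    (Phi : homeo_action G X) : Prop :=
  [/\ cantor_action Phi, equicontinuous_action Phi &
      exists U : set X,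
        [/\ adapted Phi U, U != [set: X] &
            exists (lam : X -> U)
                   (Theta : {multiplicative G -> holonomy Phi U}),
              isomorphic_by Phi (holonomy_action Phi U) lam Theta /\
              exists x0 : X,
                \bigcap_(l in [set: nat])
                   range (iter l (set_val \o lam)) = [set x0]]].

Definition virtually_renormalizable (R : realType) (G : groupType)
    (X : metricType R) (Phi : homeo_action G X) : Prop :=
  [/\ cantor_action Phi, equicontinuous_action Phi &
      exists2 V : set X,
        adapted Phi V & renormalizable (holonomy_action Phi V)].

Definition diam (R : realType) (X : metricType R) (U : set X) : \bar R :=
  ereal_sup [set (mdist p.1 p.2)%:E | p in U `*` U].

Definition locally_quasi_analytic (R : realType) (G : groupType)
    (X : metricType R) (Phi : homeo_action G X) : Prop :=
  exists2 e : R, 0 < e &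
    forall U V : set X, open U -> U !=set0 -> (diam U < e%:E)%E ->
      open V -> V !=set0 -> V `<=` U ->
      forall g : G, Phi g @` V = V -> (forall x, V x -> Phi g x = x) ->
        forall x, U x -> Phi g x = x.

(* [renorm_space R phi] is the inverse limit of the sets of left cosets of
   [level l := phi^l(G)]. An element is a sequence of nested cosets: the bonding
   map sends a coset of [level l.+1] to the only coset of [level l] containing
   it. The parameter [R] is only there to fix the values of the metric. *)
Section RenormalizationSpace.
Context (R : realType) (G : groupType) (phi : {multiplicative G -> G}).

Definition level (l : nat) : set G := range (iter l phi).

Definition coset_seq (x : nat -> set G) : Prop :=
  (forall l, exists g, x l = lmul g (level l)) /\
  (forall l, x l.+1 `<=` x l).

Record renorm_space : Type := RenormSpace {
  coord :> nat -> set G;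
  coordP : `[< coset_seq coord >] }.

HB.instance Definition _ := [isSub for coord].
HB.instance Definition _ := gen_eqMixin renorm_space.
HB.instance Definition _ := gen_choiceMixin renorm_space.

Implicit Types x y z : renorm_space.

Lemma renorm_space_eq x y : (forall l, x l = y l) -> x = y.
Proof. by move=> xy; apply: val_inj; apply/funext. Qed.

Definition differ x y : pred nat := fun l => x l != y l.

(* [2 ^- n] with [n] the first level at which [x] and [y] differ *)
Definition renorm_dist x y : R :=
  if pselect (exists l, differ x y l) is left xy then 2 ^- ex_minn xy else 0.

Lemma renorm_dist_le x y n : x n <> y n -> 2 ^- n <= renorm_dist x y.
Proof.
move=> xyn; have dn : differ x y n by apply/eqP.
rewrite /renorm_dist; case: pselect => [h|[]]; last by exists n.
case: ex_minnP => m _ /(_ _ dn) mn.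
by rewrite lef_pV2 ?posrE ?exprn_gt0// ler_eXn2l// ltr1n.
Qed.

Lemma renorm_distP x y : renorm_dist x y = 0 /\ x = y \/
  exists2 n, renorm_dist x y = 2 ^- n & x n <> y n.
Proof.
rewrite /renorm_dist; case: pselect => [h|h].
  by right; case: ex_minnP => m /eqP dm _; exists m.
left; split=> //; apply: renorm_space_eq => l.
by apply/eqP/negP => /negP xyl; apply: h; exists l.
Qed.

Fact renorm_dist_ge0 x y : 0 <= renorm_dist x y.
Proof.
by case: (renorm_distP x y) => [[-> _]//|[n -> _]]; rewrite invr_ge0 exprn_ge0.
Qed.

Fact renorm_dist_positivity x y : renorm_dist x y = 0 -> x = y.
Proof.
case: (renorm_distP x y) => [[_ ->]//|[n -> _] /eqP].
by rewrite invr_eq0 expf_eq0 pnatr_eq0 andbF.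
Qed.

Fact renorm_distxx x : renorm_dist x x = 0.
Proof. by case: (renorm_distP x x) => [[]//|[n _]]. Qed.

Fact renorm_dist_sym x y : renorm_dist x y = renorm_dist y x.
Proof.
suff le a b : renorm_dist a b <= renorm_dist b a by apply/le_anti; rewrite !le.
case: (renorm_distP a b) => [[-> _]|[n -> abn]]; first exact: renorm_dist_ge0.
by apply: renorm_dist_le => /esym.
Qed.

Fact renorm_dist_triangle y x z :
  renorm_dist x z <= renorm_dist x y + renorm_dist y z.
Proof.
case: (renorm_distP x z) => [[-> _]|[n -> xzn]].
  by rewrite addr_ge0// renorm_dist_ge0.
have [xyn|xyn] := eqVneq (x n) (y n).
  rewrite -[leLHS]add0r lerD ?renorm_dist_ge0//.
  by apply: renorm_dist_le; rewrite -xyn.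
rewrite -[leLHS]addr0 lerD ?renorm_dist_ge0//.
by apply: renorm_dist_le; apply/eqP.
Qed.

HB.instance Definition _ := @isMetric.Build R renorm_space
  renorm_dist renorm_distxx renorm_dist_positivity renorm_dist_sym
  renorm_dist_triangle.

Lemma levelS l : level l.+1 `<=` level l.
Proof. by move=> _ [g _ <-]; exists (phi g) => //; rewrite -iterSr. Qed.

Lemma level_mul l g h : level l g -> level l h -> level l (g * h)%g.
Proof.
move=> [a _ <-] [b _ <-]; exists (a * b)%g => //.
by elim: l => //= l ->; rewrite gmulfM.
Qed.

Lemma level_inv l g : level l g -> level l g^-1%g.
Proof.
have phiV (h : G) : phi h^-1%g = (phi h)^-1%g.
  have phi1 : phi 1%g = 1%g.
    by apply: (mulgI (phi 1%g)); rewrite -gmulfM !mulg1.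
  by apply: (mulgI (phi h)); rewrite -gmulfM !mulgV.
by move=> [a _ <-]; exists a^-1%g => //; elim: l => //= l ->.
Qed.

Lemma level1 l : level l 1%g.
Proof.
rewrite -(mulgV (iter l phi 1%g)).
by apply: level_mul; [|apply: level_inv]; exists 1%g.
Qed.

Lemma coset_sub_eq l g h C : C !=set0 ->
  C `<=` lmul g (level l) -> C `<=` lmul h (level l) ->
  lmul g (level l) = lmul h (level l).
Proof.
move=> [c Cc] /(_ _ Cc)[a la ac] /(_ _ Cc)[b lb bc].
apply/seteqP; split=> _ [d ld <-].
  exists (b * a^-1 * d)%g; first by do 2?apply: level_mul => //; apply: level_inv.
  by rewrite !mulgA bc -ac mulgK.
exists (a * b^-1 * d)%g; first by do 2?apply: level_mul => //; apply: level_inv.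
by rewrite !mulgA ac -bc mulgK.
Qed.

Lemma coordS_inj x y l : x l.+1 = y l.+1 -> x l = y l.
Proof.
move: (asboolP _ (coordP x)) (asboolP _ (coordP y)) => [xc xS] [yc yS] xyl.
move: (xc l) (yc l) (xS l) (yS l) (xc l.+1) => [g ->] [h ->] xg yh [k xk].
apply: coset_sub_eq xg _; last by rewrite xyl.
by exists k; rewrite xk; exists 1%g; rewrite ?mulg1//; exact: level1.
Qed.

(* The metric induces the inverse limit topology. *)
Lemma nbhs_renorm_spaceE x (A : set renorm_space) :
  nbhs x A <-> exists l, [set y : renorm_space | y l = x l] `<=` A.
Proof.
split=> [/nbhs_ballP[e /= e0 eA]|[l lA]]; last first.
  apply/nbhs_ballP; exists (2 ^- l) => /=; first by rewrite invr_gt0 exprn_gt0.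
  move=> y; rewrite ballEmdist /= => xy; apply: lA => /=.
  by apply: contrapT => /nesym /renorm_dist_le; rewrite leNgt xy.
have [l l_lt] : exists l, 2 ^- l < e.
  exists (Num.bound e^-1).
  rewrite invf_plt ?posrE ?exprn_gt0//.
  apply: (@lt_le_trans _ _ (Num.bound e^-1)%:R).
    by rewrite archi_boundP// invr_ge0 ltW.
  by rewrite -natrX ler_nat ltnW// ltn_expl.
exists l => y /= yx; apply: eA; rewrite ballEmdist /=.
have xyE n : (n <= l)%N -> x n = y n.
  move=> /subnK; move: (l - n)%N => k; elim: k n => [n|k IH n].
    by rewrite add0n => ->.
  by rewrite addSnnS => /IH /coordS_inj.
rewrite /mdist /=; case: (renorm_distP x y) => [[-> _]//|[n -> xyn]].
apply: le_lt_trans l_lt; rewrite lef_pV2 ?posrE ?exprn_gt0// ler_eXn2l// ?ltr1n//.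
by rewrite leqNgt; apply/negP => /ltnW /xyE.
Qed.

Fact translate_subproof g x : `[< coset_seq (fun l => lmul g (x l)) >].
Proof.
apply/asboolP; case/asboolP: (coordP x) => xc xS; split=> l.
  by have [h ->] := xc l; exists (g * h)%g; rewrite lmulM.
exact/image_subset/xS.
Qed.

Definition translate g x : renorm_space := RenormSpace (translate_subproof g x).

Fact translate1 x : translate 1%g x = x.
Proof. by apply: renorm_space_eq => l; rewrite /= lmul1. Qed.

Fact translateM g h x : translate (g * h)%g x = translate g (translate h x).
Proof. by apply: renorm_space_eq => l; rewrite /= lmulM. Qed.

Fact translate_continuous g : continuous (translate g).
Proof.
move=> x A /nbhs_renorm_spaceE[l lA]; apply/nbhs_renorm_spaceE.
by exists l => y /= yx; apply: lA; rewrite /= yx.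
Qed.

Definition renorm_action : homeo_action G renorm_space :=
  HomeoAction translate1 translateM translate_continuous.

End RenormalizationSpace.

(* Main.v *)
From HB Require Import structures.
Require Import Defs.
From mathcomp Require Import all_boot all_order all_algebra finmap.
From mathcomp Require Import all_classical all_reals all_analysis.

Set Implicit Arguments.
Unset Strict Implicit.
Unset Printing Implicit Defensive.

Import Order.TTheory GRing.Theory Num.Theory.

Local Open Scope classical_set_scope.
Local Open Scope ring_scope.

(** Both directions go through one object: a self-map [f] of [X] that is a
homeomorphism onto a proper adapted clopen set, conjugates the action of [G] to
that of the stabilizer of its image, and shrinks [X] to a point under iteration.
By [renormalizable_similarity] and [similarity_renormalizable], an
equicontinuous Cantor action is renormalizable exactly when it is faithful and
has such an [f]; faithfulness is forced because the target [H_U] of the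
isomorphism [Theta] consists of homeomorphisms.

For a renormalization [phi], applying [phi] to each coset of a point of the
inverse limit and shifting the levels by one gives such an [f]
([shift_similarity], [shift_contracting]): it satisfies [f (g x) = phi g (f x)],
its image is the cylinder at level 1, whose stabilizer is [phi(G)], and the
image of its [l]-th iterate is the cylinder around the base point at level [l].
The one obstacle is that [G] may act with a kernel. The group [H_V] for [V] the
whole space is the quotient by that kernel, so the adapted set [V = X] makes the
action virtually renormalizable ([similarity_virtually_renormalizable]).

Conversely, let [f] come from a renormalizable locally quasi-analytic action. If
[g] fixes a nonempty open set pointwise, then the conjugate of [g] by a high
iterate of [f] fixes pointwise an open subset of a set of small diameter, hence
all of that set, which is the image of the iterate; undoing the conjugation, [g]
acts trivially on [X], so that [g = 1] ([quasi_analytic]). Therefore an element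
of the stabilizer of [f(X)] is determined by its restriction to [f(X)], and
conjugation by [f] lifts to an injective endomorphism [phi] of [G] with image
this stabilizer. The image has finite index because the translates of [f(X)] are
open sets covering a compact space, any two of which are disjoint or equal.
Since the stabilizer of [f^l(X)] is [phi^l(G)], the elements that carry [f^l(X)]
onto a set containing a given [x] form one coset of [phi^l(G)]. Sending [x] to
the sequence of these cosets is the isomorphism with the inverse limit
([address_isomorphic]); equicontinuity makes it injective, because it makes all
translates of [f^l(X)] uniformly small. *)

(** * Groups, cosets and iterated images *)

Section Cosets.
Context (G : groupType).
Implicit Types (g h a : G) (C : set G).

Lemma mem_lmul g C a : lmul g C a <-> C (g^-1 * a)%g.
Proof.
split=> [[c Cc <-]|Ca]; first by rewrite mulgA mulVg mul1g.
by exists (g^-1 * a)%g => //; rewrite mulgA mulgV mul1g.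
Qed.

Lemma lmul_setT g : lmul g [set: G] = [set: G].
Proof. by apply/seteqP; split=> // h _; apply/mem_lmul. Qed.

Lemma lmul_image (H : groupType) (f : {multiplicative G -> H}) g C :
  f @` lmul g C = lmul (f g) (f @` C).
Proof.
apply/seteqP; split=> [_ [_ [c Cc <-] <-]|_ [_ [c Cc <-] <-]].
  by rewrite gmulfM; exists (f c) => //; exists c.
by exists (g * c)%g; [exists c|rewrite gmulfM].
Qed.

End Cosets.

(** Endomorphisms are obtained below by choice, as bare functions; this
packages them. *)
Lemma multiplicative_of_morph (G H : groupType) (f : G -> H) :
  {morph f : g h / (g * h)%g} -> exists F : {multiplicative G -> H}, F =1 f.
Proof.
move=> fM.
pose F : {multiplicative G -> H} := HB.pack f (isMultiplicative.Build G H f fM).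
by exists F.
Qed.

Lemma multiplicative1 (G H : groupType) (f : {multiplicative G -> H}) :
  f 1%g = 1%g.
Proof. by apply: (mulgI (f 1%g)); rewrite -gmulfM !mulg1. Qed.

Lemma multiplicativeV (G H : groupType) (f : {multiplicative G -> H}) g :
  f g^-1%g = (f g)^-1%g.
Proof. by apply: (mulgI (f g)); rewrite -gmulfM !mulgV multiplicative1. Qed.

Lemma inj_surj_bijective (A B : Type) (f : A -> B) :
  injective f -> (forall b, exists a, f a = b) -> bijective f.
Proof.
by move=> finj /choice[f' fK]; exists f' => // a; apply: finj; rewrite fK.
Qed.

Section Levels.
Context (G : groupType) (phi : {multiplicative G -> G}).

Lemma level_setT : level phi 0 = [set: G].
Proof. exact: image_id. Qed.

Lemma level_image l : level phi l.+1 = phi @` level phi l.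
Proof. by rewrite /level image_comp. Qed.

Lemma level_range : level phi 1 = range phi.
Proof. by []. Qed.

Lemma lmul_level l g h : level phi l (g^-1 * h)%g ->
  lmul g (level phi l) = lmul h (level phi l).
Proof.
move=> gh; apply/seteqP; split=> a /mem_lmul ga; apply/mem_lmul.
  by have := level_mul (level_inv gh) ga; rewrite invgM invgK !mulgA mulgK.
by have := level_mul gh ga; rewrite !mulgA mulgK.
Qed.

Lemma mem_lmul_level l g : lmul g (level phi l) g.
Proof. by apply/mem_lmul; rewrite mulVg; exact: level1. Qed.

End Levels.

(** * Group actions *)

Section Actions.
Context (G : groupType) (X : topologicalType) (Phi : homeo_action G X).
Implicit Types (g h : G) (x y : X) (A U : set X).

Lemma actK g : cancel (Phi g) (Phi g^-1%g).
Proof. by move=> x; rewrite -actM mulVg act1. Qed.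

Lemma actKV g : cancel (Phi g^-1%g) (Phi g).
Proof. by move=> x; rewrite -actM mulgV act1. Qed.

Lemma mem_act g A x : (Phi g @` A) x <-> A (Phi g^-1%g x).
Proof.
split=> [[y Ay <-]|Ax]; first by rewrite actK.
by exists (Phi g^-1%g x); rewrite ?actKV.
Qed.

Lemma act_preimage g A : Phi g @` A = Phi g^-1%g @^-1` A.
Proof. by apply/seteqP; split=> x /mem_act. Qed.

Lemma act_open g A : open A -> open (Phi g @` A).
Proof.
rewrite act_preimage => oA.
by apply: open_comp => // x _; exact: act_continuous.
Qed.

Lemma act_closed g A : closed A -> closed (Phi g @` A).
Proof.
rewrite act_preimage => cA.
by apply: closed_comp => // x _; exact: act_continuous.
Qed.

Lemma act_set1 A : Phi 1%g @` A = A.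
Proof. by rewrite -[RHS]image_id; apply: eq_imagel => x _; rewrite act1. Qed.

Lemma act_setM g h A : Phi (g * h)%g @` A = Phi g @` (Phi h @` A).
Proof. by rewrite image_comp; apply: eq_imagel => x _; rewrite actM. Qed.

Lemma stabilizerM U g h :
  stabilizer Phi U g -> stabilizer Phi U h -> stabilizer Phi U (g * h)%g.
Proof. by rewrite /stabilizer /= act_setM => gU ->. Qed.

Lemma stabilizerV U g : stabilizer Phi U g -> stabilizer Phi U g^-1%g.
Proof.
by rewrite /stabilizer /= => gU; rewrite -[in LHS]gU -act_setM mulVg act_set1.
Qed.

Definition faithful := forall g, (forall x, Phi g x = x) -> g = 1%g.

Lemma faithful_inj : faithful ->
  forall g h, (forall x, Phi g x = Phi h x) -> g = h.
Proof.
move=> fP g h gh; apply: (mulgI h^-1%g); rewrite mulVg; apply: fP => x.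
by rewrite actM gh actK.
Qed.

End Actions.

Lemma set_val_continuous (X : topologicalType) (U : set X) :
  continuous (set_val : U -> X).
Proof. exact: initial_continuous. Qed.

Lemma continuous_set_type (X Y : topologicalType) (U : set X) (f : Y -> U) :
  continuous (set_val \o f) -> continuous f.
Proof.
move=> /continuousP cf; apply/continuousP => _ [B oB <-].
by rewrite -comp_preimage; exact: cf.
Qed.

Section HolonomyElements.
Context (G : groupType) (X : topologicalType) (Phi : homeo_action G X).
Variable U : set X.

Lemma holonomyP (w : holonomy Phi U) : exists2 g, stabilizer Phi U g &
  forall x : U, set_val (w x) = Phi g (set_val x).
Proof. exact/asboolP/(holonomy_valP w). Qed.

Lemma holonomy_eq (w w' : holonomy Phi U) : (forall x, w x = w' x) -> w = w'.
Proof. by move=> ww'; apply: val_inj; exact: homeo_eq. Qed.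

(** The inverse demanded of an element of [homeo U] is the restriction of the
action of [g^-1], which also stabilizes [U]. *)
Lemma stabilizer_holonomy g : stabilizer Phi U g ->
  exists w : holonomy Phi U, forall x : U, set_val (w x) = Phi g (set_val x).
Proof.
move=> gU.
have restr h : stabilizer Phi U h ->
    exists r : U -> U, forall x, set_val (r x) = Phi h (set_val x).
  move=> hU; have Ur (x : U) : U (Phi h (set_val x)).
    by rewrite -[X in X (Phi _ _)]hU; exists (set_val x) => //; exact: set_valP.
  by exists (fun x => SigSub (mem_set (Ur x))).
have [r rE] := restr _ gU; have [r' r'E] := restr _ (stabilizerV gU).
have rP : `[< homeo_pair (r, r').1 (r, r').2 >].
  have cP h s : (forall x : U, set_val (s x) = Phi h (set_val x)) ->
      continuous (s : U -> U).
    move=> sE; apply: continuous_set_type => x.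
    rewrite (_ : set_val \o s = Phi h \o set_val); last exact/funext.
    apply: continuous_comp; first exact: set_val_continuous.
    exact: act_continuous.
  apply/asboolP; split=> /=; [move=> x|move=> x|exact: cP rE|exact: cP r'E].
    by apply: val_inj; rewrite [LHS]r'E rE actK.
  by apply: val_inj; rewrite [LHS]rE r'E actKV.
have rH : (Homeo rP : homeo U) \in holonomy_pred Phi (U:=U).
  by apply/asboolP; exists g.
by exists (Holonomy rH).
Qed.

End HolonomyElements.

(** * Renormalizations as contracting self-similarities *)

(** The data [(U, lambda, Theta)] of a renormalization written without the
subtype [U] and without its group of homeomorphisms: [f] is [lambda] followed
by the inclusion of [U = range f]. The last two fields say that conjugation by
[f] maps [G] into, and onto, the group of restrictions to [U] of the elements
that stabilize [U]. *)
Record self_similarity (G : groupType) (X : topologicalType)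
    (Phi : homeo_action G X) (f : X -> X) : Prop := SelfSimilarity {
  similarity_inj : injective f;
  similarity_continuous : continuous f;
  similarity_open : forall A, open A -> open (f @` A);
  similarity_adapted : adapted Phi (range f);
  similarity_proper : range f != [set: X];
  similarity_conj : forall g, exists2 g', stabilizer Phi (range f) g' &
    forall x, f (Phi g x) = Phi g' (f x);
  similarity_unconj : forall g', stabilizer Phi (range f) g' -> exists g,
    forall x, f (Phi g x) = Phi g' (f x) }.

Definition contracting_to (X : Type) (f : X -> X) (x0 : X) : Prop :=
  \bigcap_(l in [set: nat]) range (iter l f) = [set x0].

Section RenormalizableP.
Context (R : realType) (G : groupType) (X : metricType R).
Variable Phi : homeo_action G X.

(** Faithfulness comes from [Theta]: an element acting trivially on [X] has as
image the identity homeomorphism of [U], and [Theta] is injective. *)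
Lemma renormalizable_similarity : renormalizable Phi ->
  faithful Phi /\
  exists f x0, self_similarity Phi f /\ contracting_to f x0.
Proof.
case=> _ _ [U [adU UT [lam [Th [[Thb [k [lamK kK clam ck] E]] [x0 Hx0]]]]]].
have eqv g x : lam (Phi g x) = Th g (lam x) by rewrite E /= kK.
have Ef : range (set_val \o lam) = U.
  apply/seteqP; split=> [_ [x _ <-]|x Ux]; first exact: set_valP.
  by exists (k (SigSub (mem_set Ux))) => //; rewrite /comp kK.
split.
  move=> g g1; apply: (bij_inj Thb); apply: holonomy_eq => u.
  by rewrite -[u]kK -!eqv g1 act1.
exists (set_val \o lam), x0; split => //; split; rewrite ?Ef //.
- by move=> x y /val_inj /(can_inj lamK).
- move=> x; apply: continuous_comp; [exact: clam|exact: set_val_continuous].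
- move=> A oA.
  (* An open set of U is the trace of an open set of X, and U itself is open. *)
  have [B oB BE] : open (k @^-1` A) by apply: open_comp => // u _; exact: ck.
  have -> : [set (set_val \o lam) x | x in A] = U `&` B; last first.
    by apply: openI => //; case: adU => _ [].
  apply/seteqP; split=> [_ [x Ax <-]|y [Uy By]].
    split; first exact: set_valP.
    have : (k @^-1` A) (lam x) by rewrite /preimage /= lamK.
    by rewrite -BE.
  set u : U := SigSub (mem_set Uy).
  have : (set_val @^-1` B) u by [].
  by rewrite BE => Aku; exists (k u) => //=; rewrite kK.
- move=> g; have [g' sg' g'E] := holonomyP (Th g).
  by exists g' => // x; rewrite /= eqv g'E.
- move=> g' /stabilizer_holonomy[w wE]; case: Thb => Th' _ ThK.
  by exists (Th' w) => x; rewrite /= eqv ThK wE.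
Qed.

(** [Theta g] is the conjugate of the action of [g] by [f]; faithfulness of the
action makes [Theta] injective. *)
Lemma similarity_renormalizable (f : X -> X) (x0 : X) :
  cantor_action Phi -> equicontinuous_action Phi -> faithful Phi ->
  self_similarity Phi f -> contracting_to f x0 -> renormalizable Phi.
Proof.
move=> cP eP fP [finj fc fo fad fprop fconj funconj] fx0; split => //.
exists (range f); split=> //.
pose lam x : range f := SigSub (mem_set (imageP f (I : [set: X] x))).
have lamE x : set_val (lam x) = f x by [].
have lam_surj (u : range f) : exists x, lam x = u.
  by have [x _ xu] := set_valP u; exists x; apply: val_inj.
have lam_inj : injective lam by move=> x y /(congr1 set_val) /finj.
have [k lamK kK] := inj_surj_bijective lam_inj lam_surj.
have lamk : homeo_pair lam k.
  split=> //; first by apply: continuous_set_type; exact: fc.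
  apply/continuousP => A oA; exists (f @` A); first exact: fo.
  apply/seteqP; split=> u.
    move=> [x Ax xu]; suff -> : u = lam x by rewrite /preimage /= lamK.
    exact: val_inj.
  by move=> Aku; exists (k u) => //; rewrite -lamE kK.
have /choice[Th ThE] g : exists w : holonomy Phi (range f),
    forall x, w (lam x) = lam (Phi g x).
  have [g' sg' g'E] := fconj g; have [w wE] := stabilizer_holonomy sg'.
  by exists w => x; apply: val_inj; rewrite [LHS]wE [RHS]g'E.
have ThM : {morph Th : g h / (g * h)%g}.
  move=> g h; apply: holonomy_eq => u; rewrite -[u]kK ThE actM.
  by rewrite -!ThE.
have [TH THE] := multiplicative_of_morph ThM.
exists lam, TH; split; last by exists x0.
split; last first.
  exists k => // g; apply/funext => x /=.
  by rewrite THE ThE lamK.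
apply: (@eq_bij _ _ Th); last by move=> g; rewrite THE.
apply: inj_surj_bijective => [g h gh|w].
  by apply: (faithful_inj fP) => x; apply: lam_inj; rewrite -!ThE gh.
have [g' /funconj[g gE] wE] := holonomyP w.
exists g; apply: holonomy_eq => u; rewrite -[u]kK ThE; apply: val_inj.
by rewrite [RHS]wE; exact: gE.
Qed.

End RenormalizableP.

(** * Passing to the effective quotient *)

Lemma finitely_generated_surj (G H : groupType) (f : {multiplicative G -> H}) :
  (forall h, exists g, f g = h) -> finitely_generated G -> finitely_generated H.
Proof.
move=> fsurj [s sG]; exists (map f s) => S [S1 SV] sS h.
have [g <-] := fsurj h.
apply: (sG [pred a | f a \in S]) => [|a sa]; last first.
  by rewrite inE; apply: sS; exact: map_f.
split=> [|a b]; rewrite !inE; first by rewrite multiplicative1.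
by move=> Sa Sb; rewrite gmulfM multiplicativeV; exact: SV.
Qed.

Lemma cantor_space_like_homeo (X Y : topologicalType)
    (h : X -> Y) (k : Y -> X) :
  homeo_pair h k -> cantor_space_like X -> cantor_space_like Y.
Proof.
move=> [hK kK ch ck] [[x0 _] [[_ pX] coX hX zX]]; split; first by exists (h x0).
split.
- split; first exact: closedT.
  apply/seteqP; split=> // y _ A /= yA.
  have : limit_point [set: X] (k y) by rewrite pX.
  move=> /(_ (h @^-1` A)) [|x [xy _ Ax]].
    by apply: ch; rewrite kK.
  by exists (h x); split=> //; rewrite -(can_eq kK) hK.
- have -> : [set: Y] = h @` [set: X].
    by apply/seteqP; split=> // y _; exists (k y).
  by apply: continuous_compact => //; exact: continuous_subspaceT.
- move=> y z yz; rewrite -[y]kK -[z]kK; congr h; apply: hX => A B Ay Bz.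
  have [w [Aw Bw]] := yz _ _ (ck _ _ Ay) (ck _ _ Bz).
  by exists (k w).
- move=> y z yz; have [|A [[oA cA] Ay Az]] := zX (k y) (k z).
    by rewrite (can_eq kK).
  exists (k @^-1` A); split => //; split.
    by apply: open_comp => // w _; exact: ck.
  by apply: closed_comp => // w _; exact: ck.
Qed.

(** The holonomy group of the whole space is the quotient of [G] by the kernel
of its action. A contracting self-similarity descends to it, with all the other
hypotheses, and there the action is faithful. *)
Section EffectiveQuotient.
Context (R : realType) (G : groupType) (X : metricType R).
Context (Phi : homeo_action G X) (f : X -> X) (x0 : X).
Hypotheses (cPhi : cantor_action Phi) (ePhi : equicontinuous_action Phi).
Hypotheses (ssf : self_similarity Phi f) (fx0 : contracting_to f x0).

Local Notation Y := (set_type [set: X]).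
Local Notation H := (holonomy Phi [set: X]).
Local Notation Psi := (holonomy_action Phi [set: X]).

Lemma stabilizer_setT g : stabilizer Phi [set: X] g.
Proof.
by apply/seteqP; split=> // x _; exists (Phi g^-1%g x); rewrite ?actKV.
Qed.

Lemma set_valT_surj (x : X) : exists y : Y, set_val y = x.
Proof. by exists (to_setT x). Qed.

Lemma holonomy_faithful : faithful Psi.
Proof. by move=> w w1; apply: holonomy_eq. Qed.

Definition restriction_spec (g : G) (w : H) :=
  forall y : Y, set_val (w y) = Phi g (set_val y).

Lemma restriction_exists g : exists w, restriction_spec g w.
Proof. exact: (stabilizer_holonomy (stabilizer_setT g)). Qed.

Lemma restriction_surj w : exists g, restriction_spec g w.
Proof. by have [g _] := holonomyP w; exists g. Qed.

Lemma holonomy_finitely_generated : finitely_generated H.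
Proof.
have [res resE] := choice restriction_exists.
have resM : {morph res : g h / (g * h)%g}.
  move=> g h; apply: holonomy_eq => y; apply: val_inj.
  by rewrite [LHS]resE actM -!resE.
have [F FE] := multiplicative_of_morph resM.
apply: (@finitely_generated_surj G H F); last by case: cPhi.
move=> w; have [g gw] := restriction_surj w; exists g; rewrite FE.
by apply: holonomy_eq => y; apply: val_inj; rewrite [LHS]resE [RHS]gw.
Qed.

Lemma holonomy_cantor_action : cantor_action Psi.
Proof.
have [_ csX mPhi] := cPhi; split; first exact: holonomy_finitely_generated.
  apply: (@cantor_space_like_homeo X Y to_setT set_val) csX; split.
  - by [].
  - by move=> y; apply: val_inj.
  - by apply: continuous_set_type => x; exact: cvg_id.
  - exact: set_val_continuous.
move=> y O [z Oz] [B oB BO]; rewrite -BO in Oz.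
have [x [+ [g _ gE]]] := mPhi (set_val y) B (ex_intro B (set_val z) Oz) oB.
rewrite -gE; have [w wE] := restriction_exists g => Bg.
by exists (w y); split; [rewrite -BO /preimage /= wE|exists w].
Qed.

Lemma holonomy_equicontinuous : equicontinuous_action Psi.
Proof.
move=> e /ePhi[d d0 de]; exists d => // x y w.
have [g gw] := restriction_surj w.
by move=> /(de _ _ g); rewrite -!gw; exact.
Qed.

Let fY (y : Y) : Y := to_setT (f (set_val y)).

Let fYE y : set_val (fY y) = f (set_val y). Proof. by []. Qed.

Let image_fY (A : set Y) : fY @` A = set_val @^-1` (f @` (set_val @` A)).
Proof.
apply/seteqP; split=> [_ [y Ay <-]|z [_ [y Ay <-] fz]].
  by exists (set_val y) => //; exists y.
by exists y => //; apply: val_inj.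
Qed.

Let set_valT : range (set_val : Y -> X) = [set: X].
Proof.
by apply/seteqP; split=> // x _; have [y] := set_valT_surj x; exists y.
Qed.

Let range_fY : range fY = set_val @^-1` range f.
Proof. by rewrite image_fY set_valT. Qed.

Let restriction_image g w (A : set X) : restriction_spec g w ->
  Psi w @` (set_val @^-1` A) = set_val @^-1` (Phi g @` A).
Proof.
move=> gw; apply/seteqP; split=> [_ [y Ay <-]|y [x Ax xy]].
  by exists (set_val y) => //; rewrite -gw.
have [z zx] := set_valT_surj x; exists z; first by rewrite /preimage /= zx.
by apply: val_inj; rewrite -[RHS]xy -zx; exact: gw.
Qed.

Let preimage_inj (A B : set X) :
  (set_val : Y -> X) @^-1` A = set_val @^-1` B -> A = B.
Proof.
by move=> AB; rewrite -(image_preimage A set_valT) AB image_preimage.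
Qed.

Let restriction_stabilizer g w : restriction_spec g w ->
  stabilizer Psi (range fY) w <-> stabilizer Phi (range f) g.
Proof.
move=> gw; rewrite /stabilizer /= range_fY (restriction_image _ gw).
by split=> [/preimage_inj|->].
Qed.

Lemma effective_similarity : self_similarity Psi fY.
Proof.
have [finj fc fo [fne [fop fcl] fad] fprop fconj funconj] := ssf.
have valo (B : set X) : open B -> open ((set_val : Y -> X) @^-1` B).
  by move=> oB; exists B.
split.
- by move=> x y /(congr1 set_val) /finj /val_inj.
- apply: continuous_set_type => y.
  rewrite (_ : set_val \o fY = f \o set_val) //.
  by apply: continuous_comp; [exact: set_val_continuous|exact: fc].
- move=> A [B oB BA]; rewrite image_fY; apply/valo/fo.
  by rewrite -BA image_preimage.
- split; first by exists (fY (to_setT x0)), (to_setT x0).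
    rewrite range_fY; split; first exact: valo.
    by rewrite -openC preimage_setC; apply: valo; rewrite openC.
  move=> w; have [g gw] := restriction_surj w.
  rewrite range_fY (restriction_image _ gw) => -[y [gy fy]].
  by rewrite fad//; exists (set_val y).
- apply: contra_neq fprop; rewrite range_fY => E; apply: preimage_inj.
  by rewrite E.
- move=> w; have [g gw] := restriction_surj w.
  have [g' sg' g'E] := fconj g; have [w' gw'] := restriction_exists g'.
  exists w'; first exact/(restriction_stabilizer gw').
  by move=> y; apply: val_inj; rewrite [RHS]gw' fYE -g'E -gw.
- move=> w'; have [g' gw'] := restriction_surj w'.
  move=> /(restriction_stabilizer gw') /funconj[g gE].
  have [w gw] := restriction_exists g; exists w => y.
  by apply: val_inj; rewrite [RHS]gw' fYE -gE -gw.
Qed.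

Lemma effective_contracting : contracting_to fY (to_setT x0).
Proof.
have iterE l y : set_val (iter l fY y) = iter l f (set_val y).
  by elim: l => //= l <-.
have rangeE l : range (iter l fY) = set_val @^-1` range (iter l f).
  apply/seteqP; split=> [_ [y _ <-]|y [x _ xy]].
    by rewrite /preimage /= iterE; exists (set_val y).
  by exists (to_setT x) => //; apply: val_inj; rewrite [LHS]iterE.
apply/seteqP; split=> [y yP|_ -> l _].
  apply: val_inj => /=; have : [set x0] (set_val y); last by [].
  by rewrite -fx0 => l _; have := yP l I; rewrite rangeE.
by rewrite rangeE; have : [set x0] x0 by []; rewrite -fx0; exact.
Qed.

Lemma similarity_virtually_renormalizable : virtually_renormalizable Phi.
Proof.
split=> //; exists [set: X].
  split; [by exists x0|exact: clopenT|].
  by move=> g _; exact: stabilizer_setT.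
exact: (similarity_renormalizable holonomy_cantor_action
  holonomy_equicontinuous holonomy_faithful effective_similarity
  effective_contracting).
Qed.

End EffectiveQuotient.

(** * The inverse limit space *)

Section InverseLimit.
Context (R : realType) (G : groupType) (phi : {multiplicative G -> G}).
Hypothesis rphi : renormalization phi.

Local Notation limit := (renorm_space phi : metricType R).
Local Notation Phi := (renorm_action R phi).
Implicit Types x y : renorm_space phi.

Let phi_inj : injective phi. Proof. by case: rphi. Qed.

Lemma iter_phi_inj l : injective (iter l phi).
Proof. by elim: l => // l IH g h /phi_inj/IH. Qed.

Lemma coord_coset x l g : x l g -> x l = lmul g (level phi l).
Proof.
have [/(_ l)[h ->] _] := asboolP _ (coordP x).
by move=> /mem_lmul; exact: lmul_level.
Qed.

Lemma coord_nonempty x l : exists g, x l g.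
Proof.
have [/(_ l)[h ->] _] := asboolP _ (coordP x).
by exists h; exact: mem_lmul_level.
Qed.

Lemma coord0 x : x 0%N = [set: G].
Proof.
have [g /coord_coset ->] := coord_nonempty x 0.
by rewrite level_setT lmul_setT.
Qed.

Lemma coord_decr x l m g : (l <= m)%N -> x m g -> x l g.
Proof.
have [_ xS] := asboolP _ (coordP x).
by move=> /subnK <-; elim: (m - l)%N => // k IH /xS.
Qed.

Fact base_subproof : `[< coset_seq phi (level phi) >].
Proof.
apply/asboolP; split=> l; last exact: levelS.
by exists 1%g; rewrite lmul1.
Qed.

Definition base_point : renorm_space phi := RenormSpace base_subproof.

(** The coset [g phi^(l+1)(G)] is determined by the coset of [g] modulo
[phi(G)], of which [r] is a fixed representative, and by the coset of [b] modulo
[phi^l(G)], where [g = r phi(b)]. *)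
Lemma finite_index_level l : finite_index (level phi l).
Proof.
have [_ _ fin1] := rphi.
elim: l => [|l IH].
  apply: sub_finite_set (finite_set1 [set: G]) => _ [g _ <-].
  by rewrite level_setT lmul_setT.
pose F (C1 C2 : set G) := lmul (xget 1%g C1) (phi @` C2).
apply: sub_finite_set (finite_image2 F fin1 IH) => _ [g _ <-].
exists (lmul g (range phi)); first by exists g.
have : lmul g (level phi 1) (xget 1%g (lmul g (level phi 1))).
  by apply: xgetPex; exists g; exact: mem_lmul_level.
rewrite level_range; set r := xget _ _ => /mem_lmul[a _ aE].
exists (lmul a^-1%g (level phi l)); first by exists a^-1%g.
rewrite /F -/r lmul_image -level_image -lmulM; congr lmul.
by rewrite multiplicativeV aE invgM invgK mulgA mulgV mul1g.
Qed.

Lemma cylinder_open x l : open ([set y | y l = x l] : set limit).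
Proof.
rewrite openE => y /= yx; apply/nbhs_renorm_spaceE; exists l => z /= zy.
by rewrite zy.
Qed.

Lemma cylinder_clopen x l : clopen ([set y | y l = x l] : set limit).
Proof.
split; first exact: cylinder_open.
rewrite -[X in closed X]setCK; apply: open_closedC.
rewrite openE => y /= yx; apply/nbhs_renorm_spaceE; exists l => z /= zy.
by rewrite zy.
Qed.

(** Each coordinate takes finitely many values, so an ultrafilter selects one
value per level. The selected cosets are nested because any two consecutive
ones are coordinates of a common point; they form the limit. *)
Lemma limit_compact : compact [set: limit].
Proof.
rewrite compact_ultra => F FU _.
have FF : ProperFilter F by exact: ultra_proper.
have Fcoord l : exists C, F [set y : limit | y l = C].
  apply: contrapT => /forallNP noC.
  have := finite_index_level l; rewrite /finite_index.
  set D := (X in finite_set X) => finD.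
  have : F (\bigcap_(C in [set` fset_set D]) ~` [set y : limit | y l = C]).
    apply: filter_bigI => C _.
    by case: (in_ultra_setVsetC [set y : limit | y l = C] FU) => // /noC.
  move=> /filter_ex[y yP].
  have Dy : D (y l).
    have [g yg] := coord_nonempty y l.
    by exists g => //; rewrite (coord_coset yg).
  by apply: (yP (y l)) => //=; rewrite in_fset_set// inE.
have [x xP] := choice Fcoord.
have xseq : `[< coset_seq phi x >].
  apply/asboolP; split=> l.
    have /filter_ex[y /= <-] := xP l; have [g yg] := coord_nonempty y l.
    by exists g; rewrite (coord_coset yg).
  have [y /= [<- <-]] := filter_ex (filterI (xP l) (xP l.+1)).
  by have [_] := asboolP _ (coordP y).
exists (RenormSpace xseq); split => // A /nbhs_renorm_spaceE[l lA].
by apply: filterS (xP l); exact: lA.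
Qed.

(** Let [x] start with the coset of [g] up to level [l.+1], and let [h] lie
outside [phi(G)]. The point of the coset sequence of [g phi^l(h)] agrees with
[x] up to level [l] and not at level [l.+1]: by injectivity of [phi],
[phi^l(h)] lies outside [phi^(l+1)(G)]. *)
Lemma limit_perfect : perfect_set [set: limit].
Proof.
split; first exact: closedT.
apply/seteqP; split=> // x _ A /nbhs_renorm_spaceE[l lA].
have [_ [_ /existsNP[h /not_implyP[_ rh]]] _] := rphi.
have [g xg] := coord_nonempty x l.+1.
have xSl : lmul g (level phi l) = x l.
  by rewrite -(coord_coset (coord_decr (leqnSn l) xg)).
exists (translate (g * iter l phi h)%g base_point); split => //.
  apply/eqP => /(congr1 (fun y : renorm_space phi => y l.+1)) /=.
  rewrite (coord_coset xg) => E.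
  have /mem_lmul : lmul g (level phi l.+1) (g * iter l phi h)%g.
    by rewrite -E; exact: mem_lmul_level.
  rewrite mulgA mulVg mul1g => -[a _ aE]; apply: rh; exists a => //.
  by apply: (@iter_phi_inj l); rewrite -aE -iterSr.
apply: lA => /=; rewrite -xSl; apply/esym/lmul_level.
by rewrite mulgA mulVg mul1g; exists h.
Qed.

Lemma limit_cantor : cantor_space_like limit.
Proof.
split; first by exists base_point.
split; [exact: limit_perfect|exact: limit_compact|exact: metric_hausdorff|].
move=> x y xy; have [l xyl] : exists l, x l <> y l.
  apply: contrapT => /forallNP xyE; move/eqP: xy; apply.
  by apply: renorm_space_eq => l; apply: contrapT => /xyE.
exists [set z : limit | z l = x l]; split => //; first exact: cylinder_clopen.
by move=> /= /esym.
Qed.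

Lemma limit_minimal : minimal_action Phi.
Proof.
move=> x O [y Oy] oO.
have /nbhs_renorm_spaceE[l lO] := open_nbhs_nbhs (conj oO Oy).
have [g yg] := coord_nonempty y l; have [h xh] := coord_nonempty x l.
exists (translate (g * h^-1)%g x); split; last by exists (g * h^-1)%g.
apply: lO => /=; rewrite (coord_coset yg) (coord_coset xh) -lmulM.
by rewrite -mulgA mulVg mulg1.
Qed.

(** Translations do not increase the distance, as points that agree at a level
have translates that agree there. *)
Lemma limit_equicontinuous : equicontinuous_action Phi.
Proof.
move=> e e0; exists e => // x y g; apply: le_lt_trans; rewrite /mdist /=.
case: (renorm_distP R (translate g x) (translate g y)) => [[-> _]|[n -> gxy]].
  exact: renorm_dist_ge0.
by apply: renorm_dist_le => xy; apply: gxy; rewrite /= xy.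
Qed.

Fact shift_subproof x :
  `[< coset_seq phi (fun l => if l is l'.+1 then phi @` x l' else [set: G]) >].
Proof.
have [xc xS] := asboolP _ (coordP x).
apply/asboolP; split=> [[|l]|[|l]] //; last exact: image_subset.
  by exists 1%g; rewrite lmul1 level_setT.
by have [g ->] := xc l; exists (phi g); rewrite lmul_image level_image.
Qed.

(** The map induced by [phi] on the inverse limit. The coset at level [l.+1] is
the image of the one at level [l]; at level 0 there is only one coset. *)
Definition renorm_shift x : renorm_space phi := RenormSpace (shift_subproof x).

Lemma shift_inj : injective renorm_shift.
Proof.
move=> x y xy; apply: renorm_space_eq => l.
have /= := congr1 (fun z : renorm_space phi => z l.+1) xy.
have im (C : set G) : C = phi @^-1` (phi @` C).
  by apply/seteqP; split=> [c Cc|c [d Cd /phi_inj <-]] //; exists c.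
by move=> xyl; rewrite [LHS]im xyl -im.
Qed.

Lemma shift_coord1 x : renorm_shift x 1%N = level phi 1.
Proof. by rewrite /= coord0. Qed.

(** A point with coordinate [phi(G)] at level 1 has all its later cosets inside
[phi(G)], so taking preimages under [phi] undoes the shift. *)
Lemma range_shift : range renorm_shift = [set y | y 1%N = level phi 1].
Proof.
apply/seteqP; split=> [_ [x _ <-]|y /= y1]; first exact: shift_coord1.
have [yc yS] := asboolP _ (coordP y).
have yphi l a : y l.+1 a -> range phi a.
  by move=> /(coord_decr (ltn0Sn l)); rewrite y1.
have xP : `[< coset_seq phi (fun l => phi @^-1` y l.+1) >].
  apply/asboolP; split=> l; last by move=> g /=; exact: yS.
  have [_ /[dup] /yphi[g _ <-] yg] := coord_nonempty y l.+1.
  exists g; rewrite (coord_coset yg) level_image -lmul_image.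
  apply/seteqP; split=> h /=; last by exists h.
  by move=> [h' gh' /phi_inj <-].
exists (RenormSpace xP) => //; apply: renorm_space_eq => -[|l] /=.
  by rewrite coord0.
apply/seteqP; split=> [_ [g yg <-] //|h /[dup] /yphi[g _ <-] yg].
by exists g.
Qed.

Lemma shift_translate g x :
  renorm_shift (translate g x) = translate (phi g) (renorm_shift x).
Proof.
by apply: renorm_space_eq => -[|l] /=; rewrite (lmul_setT, lmul_image).
Qed.

Lemma stabilizer_shift : stabilizer Phi (range renorm_shift) = range phi.
Proof.
apply/seteqP; split=> [g|_ [g _ <-]].
  have : range renorm_shift base_point by rewrite range_shift.
  rewrite /stabilizer /= => sb gU.
  have : (Phi g @` range renorm_shift) base_point by rewrite gU.
  move=> [y]; rewrite range_shift /= => y1.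
  move=> /(congr1 (fun z : renorm_space phi => z 1%N)) /=.
  rewrite y1 => gE; suff : level phi 1 g by [].
  by rewrite -gE; exact: mem_lmul_level.
rewrite /stabilizer /=; apply/seteqP; split=> [_ [_ [x _ <-] <-]|_ [x _ <-]].
  by exists (translate g x) => //; rewrite shift_translate.
exists (renorm_shift (translate g^-1%g x)).
  by exists (translate g^-1%g x).
by rewrite -shift_translate -translateM mulgV translate1.
Qed.

Lemma shift_similarity :
  self_similarity Phi (renorm_shift : limit -> limit).
Proof.
split.
- exact: shift_inj.
- move=> x A /nbhs_renorm_spaceE[l lA]; apply/nbhs_renorm_spaceE.
  exists l => y /= yx; apply: lA; case: l yx {A} => //= l yx.
  by rewrite (coordS_inj yx).
- move=> A oA; rewrite openE => _ [x Ax <-].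
  have /nbhs_renorm_spaceE[l lA] := open_nbhs_nbhs (conj oA Ax).
  (* The shift maps the cylinder of x at level l onto that of its image at
     level l + 1. *)
  apply/nbhs_renorm_spaceE; exists l.+1 => y /= yx.
  have : range renorm_shift y.
    rewrite range_shift -(shift_coord1 x) /mkset.
    elim: l yx {lA} => // l IH yx; apply: IH.
    exact: (@coordS_inj _ _ y (renorm_shift x) l.+1).
  move=> [z _ zy]; exists z => //; apply: lA => /=.
  move: yx; rewrite -zy /= => zx; apply/seteqP; split=> a za.
    by have [b xb /phi_inj <-] : (phi @` x l) (phi a) by rewrite -zx; exists a.
  by have [b xb /phi_inj <-] : (phi @` z l) (phi a) by rewrite zx; exists a.
- split.
  + by exists (renorm_shift base_point), base_point.
  + rewrite range_shift; exact: (cylinder_clopen base_point 1).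
  + move=> g [_ [[_ [x _ <-] <-]]].
    rewrite range_shift /= coord0 -(level_setT phi) -level_image => gx1.
    rewrite -range_shift; have : stabilizer Phi (range renorm_shift) g => //.
    rewrite stabilizer_shift; suff : level phi 1 g by [].
    by rewrite -gx1; exact: mem_lmul_level.
- have [_ [_ /existsNP[h /not_implyP[_ rh]]] _] := rphi.
  apply/eqP => /seteqP[_ /(_ (translate h base_point) I)].
  rewrite range_shift /= => hE; apply: rh.
  by suff : level phi 1 h by []; rewrite -hE; exact: mem_lmul_level.
- move=> g; exists (phi g); first by rewrite stabilizer_shift; exists g.
  exact: shift_translate.
- move=> g'; rewrite stabilizer_shift => -[g _ <-]; exists g.
  exact: shift_translate.
Qed.

(** The base point is fixed, and a point in the image of the [l]-th iterate has
the coset of the identity at level [l]. *)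
Lemma shift_contracting : contracting_to renorm_shift base_point.
Proof.
have shift_base : renorm_shift base_point = base_point.
  by apply: renorm_space_eq => -[|l] /=; rewrite ?level_setT ?level_image.
apply/seteqP; split=> [x xP|_ -> l _]; last first.
  by exists base_point => //; elim: l => //= l ->.
apply: renorm_space_eq => l; have [y _ <-] := xP l I.
elim: l {xP} => [|l IH] /=; last by rewrite IH level_image.
by rewrite coord0 level_setT.
Qed.

End InverseLimit.

(** * Compactness and finite index *)

Lemma compact_finite_subcover (X : topologicalType) (J : choiceType)
    (U : J -> set X) : [set: X] !=set0 -> compact [set: X] ->
  (forall i, open (U i)) -> (forall x, exists i, U i x) ->
  exists2 D : set J, finite_set D & forall x, exists2 i, D i & U i x.
Proof.
move=> [x0 _] cX oU cU.
(* The equivalence of the two forms of compactness asks for a pointed space. *)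
pose XP : ptopologicalType := HB.pack X (isPointed.Build X x0).
have : @compact XP [set: X] by [].
rewrite compact_cover => /(_ J setT U (fun i _ => oU i)) [|D _ DX].
  by move=> x _; have [i Ui] := cU x; exists i.
by exists [set` D] => // x; have [i Di Ui] := DX x I; exists i.
Qed.

Lemma compact_nested_nonempty (X : topologicalType) (C : nat -> set X) :
  compact [set: X] -> (forall n, closed (C n)) ->
  (forall n, C n.+1 `<=` C n) -> (forall n, C n !=set0) ->
  \bigcap_(n in [set: nat]) C n !=set0.
Proof.
move=> cX clC decC neC.
have decCD m k : C (k + m)%N `<=` C m.
  by elim: k => // k IH; apply: subset_trans IH; exact: decC.
pose F := filter_from [set: nat] C.
have FF : ProperFilter F.
  apply: filter_from_proper => [|n _]; last exact: neC.
  apply: filter_from_filter; first by exists 0%N.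
  move=> i j _ _; exists (i + j)%N => // x Cx; split; last exact: decCD Cx.
  by move: Cx; rewrite addnC; exact: decCD.
have [x [_ clx]] := cX F FF filterT; exists x => n _.
by apply: clC => B Bx; apply: clx => //; exists n.
Qed.

Section Orbits.
Context (G : groupType) (X : topologicalType) (Phi : homeo_action G X).

(** The orbit of [x] meets [U]; move the meeting point back to [x]. *)
Lemma minimal_translate (U : set X) : minimal_action Phi ->
  open U -> U !=set0 -> forall x, exists g, (Phi g @` U) x.
Proof.
move=> mPhi oU neU x; have [y [Uy [g _ gE]]] := mPhi x U neU oU.
by exists g^-1%g; apply/mem_act; rewrite invgK gE.
Qed.

Lemma adapted_stabilizer (U : set X) g : adapted Phi U ->
  stabilizer Phi U g <-> Phi g @` U `&` U !=set0.
Proof.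
move=> [neU _ adU]; split; last exact: adU.
by rewrite /stabilizer /= => ->; rewrite setIid.
Qed.

(** The translates of [U] cover [X] by minimality, hence finitely many do. A
translate by [h] meets one of these, say by [g]; as [U] is adapted the two
coincide, so that [h] and [g] are in the same coset. *)
Lemma finite_index_stabilizer (U : set X) :
  minimal_action Phi -> compact [set: X] -> adapted Phi U ->
  finite_index (stabilizer Phi U).
Proof.
move=> mPhi cX adU; have [[u Uu] [oU _] _] := adU.
have [||||D finD coverD] :=
  @compact_finite_subcover X G (fun g => Phi g @` U) => //.
- by exists u.
- by move=> g; exact: act_open.
- by apply: minimal_translate => //; exists u.
apply: sub_finite_set (finite_image (fun g => lmul g (stabilizer Phi U)) finD).
move=> _ [h _ <-]; have [g Dg gUh] := coverD (Phi h u); exists g => //.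
have sgh : stabilizer Phi U (g^-1 * h)%g.
  apply/(adapted_stabilizer _ adU); exists (Phi (g^-1 * h)%g u); split.
    by exists u.
  by rewrite actM; apply/mem_act.
have sub : forall a b, stabilizer Phi U (a^-1 * b)%g ->
    lmul b (stabilizer Phi U) `<=` lmul a (stabilizer Phi U).
  move=> a b sab c /mem_lmul bc; apply/mem_lmul.
  by have := stabilizerM sab bc; rewrite !mulgA mulgK.
apply/seteqP; split; apply: sub => //.
by have := stabilizerV sgh; rewrite invgM invgK.
Qed.

End Orbits.

(** * The renormalization induced by a contracting self-similarity *)

Section InducedRenormalization.
Context (R : realType) (G : groupType) (X : metricType R).
Context (Phi : homeo_action G X) (f : X -> X) (x0 : X).
Hypotheses (cPhi : cantor_action Phi) (ePhi : equicontinuous_action Phi).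
Hypotheses (fPhi : faithful Phi) (ssf : self_similarity Phi f).
Hypothesis (fx0 : contracting_to f x0).
Hypothesis (lqa : locally_quasi_analytic Phi).

Local Notation piece n := (range (iter n f)).

Let cX : compact [set: X]. Proof. by case: cPhi => _ [_ []]. Qed.
Let mPhi : minimal_action Phi. Proof. by case: cPhi. Qed.

Lemma iter_similarity_inj n : injective (iter n f).
Proof. by elim: n => // n IH x y /(similarity_inj ssf) /IH. Qed.

Lemma iter_similarity_open n A : open A -> open (iter n f @` A).
Proof.
move=> oA; elim: n => [|n IH]; first by rewrite image_id.
have -> : iter n.+1 f @` A = f @` (iter n f @` A) by rewrite image_comp.
exact: (similarity_open ssf).
Qed.

Lemma piece_open n : open (piece n).
Proof. by apply: iter_similarity_open; exact: openT. Qed.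

Lemma iter_similarity_continuous n : continuous (iter n f).
Proof.
elim: n => [|n IH] x; first exact: cvg_id.
by apply: (continuous_comp (IH x)); exact: (similarity_continuous ssf).
Qed.

Lemma piece_closed n : closed (piece n).
Proof.
apply: compact_closed; first exact: metric_hausdorff.
apply: continuous_compact => //; apply: continuous_subspaceT.
exact: iter_similarity_continuous.
Qed.

Lemma pieceS n : piece n.+1 `<=` piece n.
Proof. by move=> _ [x _ <-]; exists (f x) => //; rewrite -iterSr. Qed.

(** By compactness the nested closed sets [f^n(X)], which intersect in [x0],
eventually enter each neighbourhood of [x0]. *)
Lemma piece_small (e : R) : 0 < e -> exists n,
  forall x y, piece n x -> piece n y -> mdist x y < e.
Proof.
move=> e0; have e20 : 0 < e / 2 by rewrite divr_gt0.
suff [n nP] : exists n, forall x, piece n x -> mdist x0 x < e / 2.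
  exists n => x y /nP xn /nP yn; apply: le_lt_trans (metric_triangle x x0 y) _.
  by rewrite [e]splitr ltrD // metric_sym.
apply: contrapT => /forallNP noN.
pose O := (ball x0 (e / 2))°.
have Ox0 : O x0 by apply: nbhsx_ballx.
have := @compact_nested_nonempty X (fun n => piece n `\` O) cX.
case.
- move=> n; apply: closedI; first exact: piece_closed.
  by apply: open_closedC; exact: open_interior.
- by move=> n x [/pieceS nx Ox]; split.
- move=> n; have /existsNP[x /not_implyP[nx xe]] := noN n.
  by exists x; split=> // /interior_subset; rewrite ballEmdist.
- move=> x xP; have : [set x0] x.
    by rewrite -fx0 => n _; have [] := xP n I.
  by move=> xx0; have [_] := xP 0%N I; rewrite xx0.
Qed.

Lemma iter_conj n g : exists g', forall x,
  iter n f (Phi g x) = Phi g' (iter n f x).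
Proof.
elim: n => [|n [g' IH]]; first by exists g.
have [g'' _ g''E] := similarity_conj ssf g'.
by exists g'' => x; rewrite /= IH g''E.
Qed.

(** Local quasi-analyticity becomes global through self-similarity: the
conjugate [g'] of [g] by [f^n] fixes [f^n(V)] pointwise, and for large [n] the
set [f^n(X)] is small enough for [g'] to be the identity on all of it. *)
Lemma quasi_analytic g (V : set X) : open V -> V !=set0 ->
  (forall x, V x -> Phi g x = x) -> g = 1%g.
Proof.
move=> oV [v Vv] gV; have [e e0 He] := lqa.
(* Bounding the distances by e / 2 keeps the supremum strictly below e. *)
have [n nsmall] := piece_small (divr_gt0 e0 (ltr0Sn R 1)).
have [g' g'E] := iter_conj n g.
have g'V x : (iter n f @` V) x -> Phi g' x = x.
  by move=> [y Vy <-]; rewrite -g'E gV.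
apply: fPhi => x; apply: (@iter_similarity_inj n); rewrite g'E.
apply: (He (piece n) (iter n f @` V)) => //.
- exact: piece_open.
- by exists (iter n f v), v.
- apply: (@le_lt_trans _ _ (e / 2)%:E).
    apply: ge_ereal_sup => _ [[a b] [/= na nb] <-].
    by rewrite lee_fin ltW// nsmall.
  by rewrite lte_fin ltr_pdivrMr// ltr_pMr// ltr1n.
- exact: iter_similarity_open.
- by exists (iter n f v), v.
- by move=> _ [y _ <-]; exists y.
- by rewrite -[RHS]image_id; apply: eq_imagel => y /g'V.
Qed.

Lemma similarity_eq g h : (forall x, range f x -> Phi g x = Phi h x) -> g = h.
Proof.
move=> gh; apply: (mulgI h^-1%g); rewrite mulVg.
apply: (@quasi_analytic _ (range f)).
- exact: (piece_open 1).
- by exists (f x0), x0.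
- by move=> x fx; rewrite actM gh// actK.
Qed.

(** The elements [phi (g * h)] and [phi g * phi h] act alike on the image of
[f], so they are equal by [similarity_eq]. *)
Lemma induced_morphism : exists phi : {multiplicative G -> G},
  forall g x, f (Phi g x) = Phi (phi g) (f x).
Proof.
have /choice[phi phiE] g : exists g', forall x, f (Phi g x) = Phi g' (f x).
  by have [g' _] := similarity_conj ssf g; exists g'.
have phiM : {morph phi : g h / (g * h)%g}.
  move=> g h; apply: similarity_eq => _ [x _ <-].
  by rewrite -phiE !actM !phiE.
have [F FE] := multiplicative_of_morph phiM.
by exists F => g x; rewrite FE phiE.
Qed.

Variable phi : {multiplicative G -> G}.
Hypothesis phiE : forall g x, f (Phi g x) = Phi (phi g) (f x).

Lemma induced_inj : injective phi.
Proof.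
move=> g h gh; apply: (faithful_inj fPhi) => x.
by apply: (similarity_inj ssf); rewrite !phiE gh.
Qed.

Lemma induced_range : range phi = stabilizer Phi (range f).
Proof.
apply/seteqP; split=> [_ [g _ <-]|g' sg'].
  apply/(adapted_stabilizer _ (similarity_adapted ssf)).
  exists (f (Phi g x0)); split; last by exists (Phi g x0).
  by exists (f x0); rewrite ?phiE//; exists x0.
have [g gE] := similarity_unconj ssf sg'; exists g => //.
by apply: similarity_eq => _ [x _ <-]; rewrite -phiE gE.
Qed.

Lemma induced_renormalization : renormalization phi.
Proof.
split; first exact: induced_inj; last first.
  by rewrite induced_range; apply: finite_index_stabilizer => //; case: ssf.
rewrite properEneq induced_range; split=> //.
apply: contra_neq (similarity_proper ssf) => sT.
apply/seteqP; split=> // x _.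
have [|g gx] := minimal_translate mPhi (piece_open 1) _ x.
  by exists (f x0), x0.
have : stabilizer Phi (range f) g by rewrite sT.
by move=> gf; have := (gx : (Phi g @` range f) x); rewrite gf.
Qed.

(** The stabilizer of [f^l(X)] is [phi^l(G)], in the form that uses that
[f^l(X)] is adapted. An element moving [f^(l+1)(X)] to a set that meets it also
does so for [f(X)]; hence it is [phi h] for some [h], and cancelling [f] shows
that [h] does so for [f^l(X)]. *)
Lemma level_piece l g : level phi l g <-> Phi g @` piece l `&` piece l !=set0.
Proof.
elim: l g => [|l IH] g.
  rewrite level_setT image_id setIT; split=> // _.
  by exists (Phi g x0), x0.
rewrite level_image; split.
  move=> [h /IH[_ [[y ly <-] lhy]] <-].
  exists (f (Phi h y)); split.
    by exists (f y) => //; case: ly => z _ <-; exists z.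
  by case: lhy => z _ <-; exists z.
move=> [_ [[_ [z _ <-] <-] [w _ wE]]].
have : range phi g.
  rewrite induced_range; apply/(adapted_stabilizer _ (similarity_adapted ssf)).
  exists (f (iter l f w)); split; last by exists (iter l f w).
  by exists (f (iter l f z)); [exists (iter l f z)|].
case=> h _ hE; exists h => //; apply/IH.
move: wE; rewrite -hE /= -phiE => /(similarity_inj ssf) wE.
exists (iter l f w); split; last by exists w.
by exists (iter l f z) => //; exists z.
Qed.

Lemma iter_inducedE l g x :
  iter l f (Phi g x) = Phi (iter l phi g) (iter l f x).
Proof. by elim: l => //= l ->; rewrite phiE. Qed.

Lemma level_act l g x : level phi l g -> piece l x -> piece l (Phi g x).
Proof.
by move=> [h _ <-] [y _ <-]; rewrite -iter_inducedE; exists (Phi h y).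
Qed.

Lemma translate_piece_coset l g x : (Phi g @` piece l) x ->
  [set h | (Phi h @` piece l) x] = lmul g (level phi l).
Proof.
move=> /mem_act gx; apply/seteqP; split=> h /= => [/mem_act hx|/mem_lmul gh].
  apply/mem_lmul/level_piece; exists (Phi g^-1%g x); split => //.
  by exists (Phi h^-1%g x) => //; rewrite actM actKV.
apply/mem_act; rewrite -[x](actKV Phi g) -actM.
by apply: level_act => //; have := level_inv gh; rewrite invgM invgK.
Qed.

(** * Coding points by cosets *)

Lemma address_subproof x :
  `[< coset_seq phi (fun l => [set h | (Phi h @` piece l) x]) >].
Proof.
apply/asboolP; split=> l; last first.
  by move=> h /= /mem_act /pieceS /mem_act.
have [|g gx] := minimal_translate mPhi (piece_open l) _ x.
  by exists (iter l f x0), x0.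
by exists g; exact: translate_piece_coset.
Qed.

Local Notation limit := (renorm_space phi : metricType R).

Definition address x : limit := RenormSpace (address_subproof x).

(** Points with a common address at level [n] lie in one translate of [f^n(X)].
Equicontinuity makes these translates small all together. This gives both the
injectivity of the coding and the continuity of its inverse. *)
Lemma address_small (e : R) : 0 < e -> exists n,
  forall x y, address x n = address y n -> mdist x y < e.
Proof.
move=> e0; have [d d0 de] := ePhi e0; have [n nd] := piece_small d0.
exists n => x y /= xy.
have [|g gx] := minimal_translate mPhi (piece_open n) _ x.
  by exists (iter n f x0), x0.
have gy : [set h | (Phi h @` piece n) y] g by rewrite -xy.
by case: gx gy => [a na <-] [b nb <-]; apply: de; exact: nd.
Qed.

Lemma address_inj : injective address.
Proof.
move=> x y xy; apply/eqP; rewrite -[_ == _]negbK -mdist_gt0; apply/negP => d0.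
by have [n /(_ x y)] := address_small d0; rewrite xy ltxx => /(_ erefl).
Qed.

(** A point of the inverse limit is a nested sequence of translates of the sets
[f^l(X)], and compactness provides a point in all of them. *)
Lemma address_surj (y : limit) : exists x, address x = y.
Proof.
have [/choice[g gE] yS] := asboolP _ (coordP y).
have [|||x xP] := @compact_nested_nonempty X (fun l => Phi (g l) @` piece l) cX.
- by move=> l; apply: act_closed; exact: piece_closed.
- move=> l z /mem_act gz; apply/mem_act.
  have /yS : y l.+1 (g l.+1) by rewrite gE; exact: mem_lmul_level.
  rewrite gE => /mem_lmul /level_act/(_ (pieceS gz)).
  by rewrite actM actKV.
- by move=> l; exists (Phi (g l) (iter l f x0)), (iter l f x0) => //; exists x0.
- exists x; apply: renorm_space_eq => l; rewrite gE /=.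
  by apply: translate_piece_coset; exact: xP.
Qed.

Lemma address_continuous : continuous (address : X -> limit).
Proof.
move=> x A /nbhs_renorm_spaceE[l lA].
have [|g gx] := minimal_translate mPhi (piece_open l) _ x.
  by exists (iter l f x0), x0.
have ogl : open (Phi g @` piece l) by apply: act_open; exact: piece_open.
apply: filterS (open_nbhs_nbhs (conj ogl gx)) => y gy; apply: lA => /=.
by rewrite (translate_piece_coset gx) (translate_piece_coset gy).
Qed.

Lemma address_isomorphic : isomorphic Phi (renorm_action R phi).
Proof.
have [k addrK kK] := inj_surj_bijective address_inj address_surj.
have [id_ idE] := @multiplicative_of_morph G G id (fun _ _ => erefl).
exists address, id_; split; first by exists id_ => g; rewrite !idE.
exists k.
  split=> //; first exact: address_continuous.
  move=> y A /nbhs_ballP[e e0 eA]; apply/nbhs_renorm_spaceE.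
  have [n nP] := address_small e0; exists n => z zy; apply: eA.
  by rewrite ballEmdist /=; apply: nP; rewrite !kK.
move=> g; apply/funext => x /=; rewrite idE -[LHS]addrK; congr k.
apply: renorm_space_eq => l; apply/seteqP; split=> h /=.
  move=> /mem_act hx; apply/mem_lmul => /=; apply/mem_act.
  by rewrite invgM invgK actM.
by move=> /mem_lmul /mem_act; rewrite invgM invgK actM => hx; apply/mem_act.
Qed.

End InducedRenormalization.

Theorem theorem7p5 (R : realType) :
  (forall (G : groupType) (phi : {multiplicative G -> G}),
     finitely_generated G -> renormalization phi ->
     virtually_renormalizable (renorm_action R phi)) /\
  (forall (G : groupType) (X : metricType R) (Phi : homeo_action G X),
     cantor_action Phi -> equicontinuous_action Phi ->
     renormalizable Phi -> locally_quasi_analytic Phi ->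
     group_renormalizable G /\
     exists2 phi : {multiplicative G -> G},
       renormalization phi & isomorphic Phi (renorm_action R phi)).
Proof.
split=> [G phi fgG rphi|G X Phi cPhi ePhi /renormalizable_similarity].
  apply: (@similarity_virtually_renormalizable R G
    (renorm_space phi : metricType R) _ (@renorm_shift G phi)
    (base_point phi)).
  - by split => //; [exact: limit_cantor|exact: limit_minimal].
  - exact: limit_equicontinuous.
  - exact: shift_similarity.
  - exact: shift_contracting.
move=> [fPhi [f [x0 [ssf fx0]]]] lqa.
have [phi phiE] := induced_morphism cPhi fPhi ssf fx0 lqa.
have rphi := induced_renormalization cPhi fPhi ssf fx0 lqa phiE.
split; exists phi => //.
exact: (address_isomorphic cPhi ePhi fPhi ssf fx0 lqa phiE).
Qed.
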